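(* Let $(\mathrm{P})$–$(\mathrm{D})$ be a primal-dual pair of semidefinite optimization problems with $m$ equality constraints, $n\times n$ symmetric matrices and integer data $A^1,\dots,A^m,C,b$, such that $A^1,\dots,A^m$ are linearly independent and there is a feasible $(X^\circ,y^\circ,S^\circ)$ with $X^\circ\succ 0$ and $S^\circ\succ 0$. Let $(X(\mu),y(\mu),S(\mu))$, $\mu>0$, be its central path and let $(X^{**},y^{**},S^{**})=\lim_{\mu\downarrow 0}(X(\mu),y(\mu),S(\mu))$ be the limit point of the central path. Then, when $\mu>0$ is sufficiently small, $$\|X(\mu)-X^{**}\|=O(\mu^{1/\gamma})\quad\text{and}\quad \|S(\mu)-S^{**}\|=O(\mu^{1/\gamma}),$$ where $\gamma=2^{O(m+n^2)}$. Explicitly: there is an absolute constant $c>0$ such that for every such problem there exist a number $0<\gamma\le 2^{c(m+n^2)}$ and constants $K>0$, $\mu_0>0$ (depending on the problem) with $\|X(\mu)-X^{**}\|\le K\mu^{1/\gamma}$ and $\|S(\mu)-S^{**}\|\le K\mu^{1/\gamma}$ for all $0<\mu\le\mu_0$.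
   Context: Let $\mathbb{S}^n$ be the space of real symmetric $n\times n$ matrices with inner product $\langle X,S\rangle=\operatorname{trace}(XS)$ and $\|\cdot\|$ the Frobenius norm. $X\succeq 0$ (resp. $X\succ0$) means positive semidefinite (resp. positive definite). Given $C,A^1,\dots,A^m\in\mathbb{S}^n$ and $b\in\mathbb{R}^m$, all with integer entries, the problems are $$(\mathrm{P})\quad \inf_{X\in\mathbb{S}^n}\{\langle C,X\rangle : \langle A^i,X\rangle=b_i,\ i=1,\dots,m,\ X\succeq0\},$$ $$(\mathrm{D})\quad \sup_{(y,S)\in\mathbb{R}^m\times\mathbb{S}^n}\{b^Ty : \textstyle\sum_{i=1}^m y_iA^i+S=C,\ S\succeq 0\}.$$ A triple $(X,y,S)$ is feasible if it satisfies all constraints of $(\mathrm{P})$ and $(\mathrm{D})$. Central path: under the assumptions in the claim, for each $\mu>0$ there is a unique triple $(X(\mu),y(\mu),S(\mu))$, called a central solution, satisfying $$\langle A^i,X\rangle=b_i\ (i=1,\dots,m),\quad \sum_{i=1}^m y_iA^i+S=C,\quad XS=\mu I_n,\quad X,S\succ0.$$ The central path is the map $\mu\mapsto(X(\mu),y(\mu),S(\mu))$ on $(0,\infty)$. It is known that it converges as $\mu\downarrow0$. *)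

(* Defs.v *)
From HB Require Import structures.
From mathcomp Require Import all_boot all_order all_algebra.
From mathcomp Require Import all_classical all_reals all_analysis.

Set Implicit Arguments.
Unset Strict Implicit.
Unset Printing Implicit Defensive.

Import Order.TTheory GRing.Theory Num.Theory.
Import numFieldNormedType.Exports.

Local Open Scope classical_set_scope.
Local Open Scope ring_scope.

Section Matrices.
Variables (R : realType) (n : nat).
Implicit Types X S : 'M[R]_n.

Definition mxinner X S : R := \tr (X *m S).

(* The norm attached to 'M[R]_n in the library is the max norm, hence this
   explicit Frobenius norm; on symmetric matrices it is
   Num.sqrt (mxinner X X). *)
Definition frob_norm X : R := Num.sqrt (\sum_i \sum_j X i j ^+ 2).

Definition psdmx X : Prop :=
  X^T = X /\ forall v : 'cV[R]_n, 0 <= (v^T *m X *m v) 0 0.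

Definition pdmx X : Prop :=
  X^T = X /\ forall v : 'cV[R]_n, v != 0 -> 0 < (v^T *m X *m v) 0 0.

End Matrices.

Section SDP.
Variables (R : realType) (m n : nat).
Variables (A : 'I_m -> 'M[int]_n) (b : 'cV[int]_m) (C : 'M[int]_n).

Definition realmx_of p q (M : 'M[int]_(p, q)) : 'M[R]_(p, q) :=
  map_mx intr M.

Definition primal_eqs (X : 'M[R]_n) : Prop :=
  forall i : 'I_m, mxinner (realmx_of (A i)) X = realmx_of b i 0.

Definition dual_eqs (y : 'cV[R]_m) (S : 'M[R]_n) : Prop :=
  \sum_(i < m) y i 0 *: realmx_of (A i) + S = realmx_of C.

Definition feasible (X : 'M[R]_n) (y : 'cV[R]_m) (S : 'M[R]_n) : Prop :=
  [/\ primal_eqs X, psdmx X, dual_eqs y S & psdmx S].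

Definition lin_indep_constraints : bool :=
  free [tuple realmx_of (A i) | i < m].

Definition interior_point_condition : Prop :=
  exists X y S, [/\ feasible X y S, pdmx X & pdmx S].

Definition central_solution (mu : R)
    (X : 'M[R]_n) (y : 'cV[R]_m) (S : 'M[R]_n) : Prop :=
  [/\ primal_eqs X, dual_eqs y S, X *m S = mu%:M, pdmx X & pdmx S].

(* Central solutions are unique for each mu > 0 under linear independence and
   the interior point condition, so these conditions determine the path on
   the positive reals; its values at mu <= 0 are irrelevant. *)
Definition central_path
    (X : R -> 'M[R]_n) (y : R -> 'cV[R]_m) (S : R -> 'M[R]_n) : Prop :=
  forall mu, 0 < mu -> central_solution mu (X mu) (y mu) (S mu).

End SDP.

(* Main.v *)
Require Import Defs.
From HB Require Import structures.
From mathcomp Require Import all_boot all_order all_algebra.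
From mathcomp Require Import all_classical all_reals all_analysis.

Set Implicit Arguments.
Unset Strict Implicit.
Unset Printing Implicit Defensive.

Import Order.TTheory GRing.Theory Num.Theory.
Import numFieldNormedType.Exports.

Local Open Scope classical_set_scope.
Local Open Scope ring_scope.

(** The entries of the central path are algebraic functions of [mu] of degree
    at most [D = 5 ^ (2 n^2 + m)], and an algebraic function of degree [D] that
    converges does so at the rate [mu ^ (1 / D)].

    The degree bound. For a fixed [mu > 0] the central solution is, near itself,
    the only common zero of the equations defining it ([central_solution_unique],
    using that positive definiteness is an open condition, [pdmx_open]); hence it
    is a strict local minimum of the sum [residual] of the squares of these
    equations, a polynomial of degree 4 in [N = 2 n^2 + m] unknowns. Over the
    complex numbers, however, its critical locus may have positive dimension, and
    elimination may then return the zero polynomial. Therefore the term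
    [e / 6 * \sum_i z_i ^ 6] is added. For small [e > 0] the perturbed polynomial
    still has a local minimum near the given one, and at this point
    [z_i ^ 5 = - e^-1 * g_i z] with [deg g_i < 5].
    These relations rewrite every monomial into the [5 ^ N] monomials with all
    exponents below 5, so multiplication by a coordinate becomes a matrix with
    coefficients polynomial in [mu] and [e^-1], and its characteristic polynomial
    has degree [5 ^ N] and vanishes at the coordinate ([eliminant]). When [e]
    tends to 0 only the leading coefficient in [e^-1] survives: it is a nonzero
    polynomial [Q (mu, t)] of degree at most [5 ^ N] in [t] which vanishes along
    the path ([algebraic_branch]).

    The rate. If [Q (mu, x mu) = 0], where [Q] is not divisible by [mu], then
    [Q (0, x mu) = O (mu)]. Write [Q (0, t) = (t - l)^k * u t] with [u l != 0]
    and [k <= D]; then [`|x mu - l| ^ D <= `|x mu - l| ^ k = O (mu)]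
    ([algebraic_rate]).

    Finally [5 ^ (2 n^2 + m) <= 8 ^ (2 (m + n^2)) = 2 ^ (6 (m + n^2))]. *)

(** * Elimination for systems x_i ^ (d + 1) = g_i with deg g_i <= d *)

Section WordPolynomials.
Variables (A : comNzRingType) (I : finType).

(** Multivariate polynomials are encoded as lists of pairs (coefficient,
    monomial), a monomial being the word of its variables: sums and products of
    polynomials are then concatenations, and the degree is a word length. *)
Definition peval (B : comNzRingType) (phi : A -> B) (x : I -> B)
    (s : seq (A * seq I)) : B :=
  \sum_(p <- s) phi p.1 * \prod_(i <- p.2) x i.

Definition deg_le (k : nat) (s : seq (A * seq I)) : bool :=
  all (fun p => size p.2 <= k)%N s.

End WordPolynomials.

Lemma perm_nseq_count (T : eqType) (i : T) k (w : seq T) :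
  (k <= count_mem i w)%N -> exists w', perm_eq w (nseq k i ++ w').
Proof.
elim: k w => [|k IHk] w kw; first by exists w.
have iw : i \in w by rewrite -has_pred1 has_count (leq_trans _ kw).
have /permPl pw := perm_to_rem iw.
have [|w' pw'] := IHk (rem i w).
  by move: kw; rewrite (permP (perm_to_rem iw)) /= eqxx add1n.
by exists w'; rewrite pw /= perm_cons.
Qed.

Lemma prod_nseq (B : comNzRingType) (I : Type) (x : I -> B) k i :
  \prod_(j <- nseq k i) x j = x i ^+ k.
Proof. by elim: k => [|k IHk]; rewrite ?big_nil// big_cons IHk exprS. Qed.

Section Elimination.
Variables (A : comNzRingType) (F : fieldType) (I : finType) (d : nat).
Variable g : I -> seq (A * seq I).
Hypothesis g_deg : forall i, deg_le d (g i).

Local Notation expo := {ffun I -> 'I_d.+1}.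
Definition expo_monomial (x : I -> F) (a : expo) : F := \prod_i x i ^+ a i.

Definition solves (phi : A -> F) (x : I -> F) : Prop :=
  forall i, x i ^+ d.+1 = peval phi x (g i).

Let reduces (f : (A -> F) -> (I -> F) -> F) : Prop :=
  exists r : expo -> A, forall (phi : {rmorphism A -> F}) x, solves phi x ->
    f phi x = \sum_a phi (r a) * expo_monomial x a.

Let reduces_peval n (s : seq (A * seq I)) :
  (forall w : seq I, (size w <= n)%N ->
     reduces (fun _ x => \prod_(i <- w) x i)) ->
  deg_le n s -> reduces (fun phi x => peval phi x s).
Proof.
move=> redn; elim: s => [|p s IHs] /=.
  exists (fun=> 0) => phi x _; rewrite /peval big_nil big1// => a _.
  by rewrite rmorph0 mul0r.
case/andP => /redn[rp rpE] /IHs[r rE].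
exists (fun a => p.1 * rp a + r a) => phi x sx.
rewrite /peval big_cons -/(peval phi x s) (rpE phi x sx) (rE phi x sx).
rewrite mulr_sumr -big_split; apply: eq_bigr => a _ /=.
by rewrite rmorphD rmorphM mulrDl mulrA.
Qed.

(** Replacing [x i ^+ d.+1] by [g i] inside a monomial lowers its degree, so the
    rewriting stops at monomials with all exponents at most [d]. The coefficients
    [r] are the same for all specializations [phi] of the coefficient ring. *)
Lemma word_reduces (w : seq I) : exists r : expo -> A,
  forall (phi : {rmorphism A -> F}) x, solves phi x ->
    \prod_(i <- w) x i = \sum_a phi (r a) * expo_monomial x a.
Proof.
have [n] := ubnP (size w); elim: n w => // n IHn w; rewrite ltnS => wn.
have [/forallP cw|] := boolP [forall i, (count_mem i w < d.+1)%N].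
  pose a : expo := [ffun i => Ordinal (cw i)].
  exists (fun b => (b == a)%:R) => phi x _.
  rewrite (bigD1 a)//= eqxx rmorph1 mul1r [X in _ + X]big1 ?addr0; last first.
    by move=> b /negbTE ->; rewrite rmorph0 mul0r.
  transitivity (\prod_i x i ^+ count_mem i w); last first.
    by apply: eq_bigr => i _; rewrite ffunE.
  elim: w {wn cw a} => [|j w IHw]; first by rewrite big_nil big1.
  rewrite big_cons IHw [in RHS](bigD1 j)//= eqxx add1n exprS -mulrA.
  rewrite (bigD1 j)//=; congr (_ * (_ * _)); apply: eq_bigr => i.
  by rewrite eq_sym => /negPf ->.
rewrite negb_forall => /existsP[i]; rewrite -leqNgt => /perm_nseq_count[w' pw].
have := perm_size pw; rewrite size_cat size_nseq => sw.
pose s := [seq (p.1, p.2 ++ w') | p <- g i].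
have [||r rE] := @reduces_peval (d + size w')%N s.
- move=> v vs; apply: IHn; apply: (leq_ltn_trans vs).
  by rewrite -addSn -sw.
- rewrite /deg_le all_map; apply: sub_all (g_deg i) => p /= pd.
  by rewrite size_cat leq_add2r.
- exists r => phi x sx; rewrite -rE// (perm_big _ pw) big_cat.
  rewrite (prod_nseq x d.+1 i : \prod_(j <- nseq d.+1 i) x j = _).
  rewrite sx /= /peval big_map mulr_suml; apply: eq_bigr => p _.
  by rewrite big_cat mulrA.
Qed.

Lemma expo_monomial_word (a : expo) : exists w : seq I,
  forall x : I -> F, \prod_(i <- w) x i = expo_monomial x a.
Proof.
exists (flatten [seq nseq (a i) i | i <- enum I]) => x.
rewrite big_flatten big_map big_enum.
by apply: eq_bigr => i _; rewrite prod_nseq.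
Qed.

(** By [word_reduces], multiplication by [x i0] acts on the vector of the
    [d.+1 ^ #|I|] reduced monomials through a matrix over [A]; at a solution this
    vector is an eigenvector of eigenvalue [x i0], so that [P] can be the
    characteristic polynomial. *)
Lemma eliminant (i0 : I) : exists P : {poly A},
  [/\ P \is monic, size P = (d.+1 ^ #|I|).+1 &
      forall (phi : {rmorphism A -> F}) x, solves phi x ->
        root (map_poly phi P) (x i0)].
Proof.
have /fin_all_exists[r rE] (a : expo) : exists r : expo -> A,
    forall (phi : {rmorphism A -> F}) x, solves phi x ->
    x i0 * expo_monomial x a = \sum_b phi (r b) * expo_monomial x b.
  have [w wE] := expo_monomial_word a.
  have [r rE] := word_reduces (i0 :: w).
  by exists r => phi x sx; rewrite -rE// big_cons wE.
pose M := \matrix_(j < #|{: expo}|, k < #|{: expo}|)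
  r (enum_val k) (enum_val j).
exists (char_poly M); split; first exact: char_poly_monic.
  by rewrite size_char_poly card_ffun card_ord.
move=> phi x sx; rewrite map_char_poly -eigenvalue_root_char.
apply/eigenvalueP; exists (\row_j expo_monomial x (enum_val j)).
  apply/rowP => k; rewrite !mxE (rE _ phi)//.
  rewrite (reindex _ (onW_bij _ (enum_val_bij expo)))/=.
  by apply: eq_bigr => j _; rewrite !mxE mulrC.
(* the eigenvector is nonzero because the monomial 1 is reduced *)
apply/eqP => /rowP /(_ (enum_rank [ffun=> ord0]))/eqP.
rewrite !mxE enum_rankK /expo_monomial big1 ?oner_eq0// => i _.
by rewrite ffunE expr0.
Qed.

End Elimination.

(** * Partial derivatives *)

Section Derivation.
Variables (A : comNzRingType) (I : finType) (i : I).

(** The derivative of a monomial, as the list of the words obtained by deleting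
    one occurrence of [i]. *)
Fixpoint word_deriv (w : seq I) : seq (seq I) :=
  if w is j :: w' then
    (if j == i then [:: w'] else [::]) ++ [seq j :: v | v <- word_deriv w']
  else [::].

Definition poly_deriv (s : seq (A * seq I)) : seq (A * seq I) :=
  flatten [seq [seq (p.1, v) | v <- word_deriv p.2] | p <- s].

Lemma word_deriv_size w v : v \in word_deriv w -> (size v).+1 = size w.
Proof.
elim: w v => //= j w IHw v; rewrite mem_cat => /orP[|/mapP[u /IHw <- ->//]].
by case: (j == i); rewrite //= inE => /eqP->.
Qed.

Lemma poly_deriv_deg k s : deg_le k.+1 s -> deg_le k (poly_deriv s).
Proof.
move=> /allP ds; apply/allP => _ /flatten_mapP[p /ds pk /mapP[v + ->]] /=.
by move=> /word_deriv_size vp; rewrite -ltnS vp.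
Qed.

(** The line through [x] in the direction of the [i]-th axis, parametrized by
    ['X]. *)
Definition coord_line (B : comNzRingType) (x : I -> B) (j : I) : {poly B} :=
  (x j)%:P + (if j == i then 'X else 0).

Variable B : comNzRingType.

Lemma horner_coord_line (phi : A -> B) x s t :
  (peval (polyC \o phi) (coord_line x) s).[t] =
  peval phi (fun j => x j + (if j == i then t else 0)) s.
Proof.
rewrite /peval horner_sum; apply: eq_bigr => p _.
rewrite hornerM hornerC horner_prod; congr (_ * _); apply: eq_bigr => j _.
by rewrite /coord_line !hornerE; case: (j == i); rewrite ?hornerE.
Qed.

Lemma deriv_coord_line (phi : A -> B) x s :
  (peval (polyC \o phi) (coord_line x) s)^`().[0] = peval phi x (poly_deriv s).
Proof.
have word_line w : (\prod_(j <- w) coord_line x j).[0] = \prod_(j <- w) x j.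
  rewrite horner_prod; apply: eq_bigr => j _.
  by rewrite /coord_line !hornerE; case: (j == i); rewrite ?hornerE.
have dword w : (\prod_(j <- w) coord_line x j)^`().[0] =
    \sum_(v <- word_deriv w) \prod_(j <- v) x j.
  elim: w => [|j w IHw]; first by rewrite !big_nil derivC hornerC.
  rewrite /= big_cons derivM hornerD !hornerM IHw word_line big_cat big_map.
  congr (_ + _).
    rewrite /coord_line derivD derivC add0r; case: (j == i).
      by rewrite derivX hornerC mul1r big_seq1.
    by rewrite deriv0 horner0 mul0r big_nil.
  rewrite mulr_sumr /coord_line !hornerE.
  apply: eq_bigr => v _; rewrite big_cons.
  by case: (j == i); rewrite ?hornerE ?addr0.
rewrite /peval /poly_deriv raddf_sum horner_sum big_flatten big_map.
apply: eq_bigr => p _.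
by rewrite /= deriv_mulC hornerCM dword big_map mulr_sumr.
Qed.

End Derivation.

Lemma poly_deriv_map (A B : comNzRingType) (I : finType) (f : A -> B) (i : I)
    (s : seq (A * seq I)) :
  poly_deriv i [seq (f p.1, p.2) | p <- s] =
  [seq (f p.1, p.2) | p <- poly_deriv i s].
Proof.
rewrite /poly_deriv map_flatten -!map_comp; congr flatten.
by apply: eq_map => p /=; rewrite -map_comp.
Qed.

(** * Critical points of a perturbed polynomial *)

Section PerturbedMinimum.
Variables (R : realType) (I : finType).
Implicit Types (z x : I -> R) (s : seq (R * seq I)).

(** Points [I -> R] carry the product topology, so that cubes are compact by
    Tychonoff's theorem. *)
Lemma peval_continuous s : continuous (fun z : {ptws I -> R} => peval id z s).
Proof.
have cadd : continuous (fun x : R * R => x.1 + x.2).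
  by move=> x; apply: cvgD; [exact: cvg_fst|exact: cvg_snd].
have cmul : continuous (fun x : R * R => x.1 * x.2).
  by move=> x; apply: cvgM; [exact: cvg_fst|exact: cvg_snd].
have cw (w : seq I) : continuous (fun z : {ptws I -> R} => \prod_(i <- w) z i).
  apply: (@continuous_big R I *%R 1 xpredT cmul
    {ptws I -> R} w (fun i z => z i)) => i _.
  exact: (@proj_continuous I (fun=> R) i).
have cp (p : R * seq I) :
    continuous (fun z : {ptws I -> R} => p.1 * \prod_(i <- p.2) z i).
  move=> z; apply: (@cvgM R _ (nbhs z) _ (fun=> p.1)
    (fun z : {ptws I -> R} => \prod_(i <- p.2) z i)); first exact: cvg_cst.
  exact: cw.
exact: (@continuous_big R (R * seq I)%type +%R 0 xpredT cadd
  {ptws I -> R} s (fun p z => p.1 * \prod_(i <- p.2) z i)).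
Qed.

Lemma peval_deriv_min s z h i : 0 < h ->
  (forall t, `|t| < h ->
    peval id z s <= peval id (fun j => z j + (if j == i then t else 0)) s) ->
  peval id z (poly_deriv i s) = 0.
Proof.
move=> h0 zmin; pose p := peval (polyC \o id) (coord_line i z) s.
have pE t : p.[t] = peval id (fun j => z j + (if j == i then t else 0)) s.
  exact: horner_coord_line.
have p0 : p.[0] = peval id z s.
  rewrite pE; congr (peval id _ s); apply/funext => j.
  by case: (j == i); rewrite addr0.
have d0 : is_derive (0 : R) (1 : R) (horner p) 0.
  apply: (@derive1_at_min R _ (- h) h).
  - by rewrite -subr_ge0 opprK addr_ge0 ?ltW.
  - by move=> t _; exact: derivable_horner.
  - by rewrite in_itv/= oppr_lt0 h0.
  - move=> t; rewrite in_itv/= -ltr_norml => th.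
    by rewrite p0 pE zmin.
rewrite -(deriv_coord_line i id z s) -/p.
have dp := is_derive_poly p 0.
by rewrite -(@derive_val _ _ _ _ _ _ _ dp) (@derive_val _ _ _ _ _ _ _ d0).
Qed.

Lemma peval_cat s1 s2 z :
  peval id z (s1 ++ s2) = peval id z s1 + peval id z s2.
Proof. by rewrite /peval big_cat. Qed.

Lemma poly_deriv_cat i s1 s2 :
  poly_deriv i (s1 ++ s2) = poly_deriv i s1 ++ poly_deriv i s2.
Proof. by rewrite /poly_deriv map_cat flatten_cat. Qed.

Definition power_sum (k : nat) (c : R) : seq (R * seq I) :=
  [seq (c, nseq k j) | j <- enum I].

Lemma peval_power_sum k c z : peval id z (power_sum k c) = c * \sum_j z j ^+ k.
Proof.
rewrite /peval /power_sum big_map big_enum mulr_sumr; apply: eq_bigr => j _.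
by rewrite prod_nseq.
Qed.

Lemma peval_word_deriv_nseq k i j z :
  \sum_(v <- word_deriv i (nseq k j)) \prod_(l <- v) z l =
  if j == i then k%:R * z i ^+ k.-1 else 0.
Proof.
elim: k => [|k IHk] /=; first by rewrite big_nil mul0r if_same.
rewrite big_cat big_map /=; under [X in _ + X]eq_bigr do rewrite big_cons.
rewrite -mulr_sumr IHk; case: eqP => [->|_].
  rewrite big_seq1 prod_nseq mulrCA; case: k {IHk} => [|k].
    by rewrite mul0r addr0 expr0 mulr1.
  by rewrite -exprS /= [in RHS]mulrS mulrDl mul1r.
by rewrite big_nil mulr0 addr0.
Qed.

Lemma peval_deriv_power_sum k c i z :
  peval id z (poly_deriv i (power_sum k c)) = c * (k%:R * z i ^+ k.-1).
Proof.
rewrite /peval /poly_deriv /power_sum big_flatten 2!big_map big_enum.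
rewrite (bigD1 i)//=.
rewrite [X in _ + X]big1 ?addr0 => [|j /negPf ji].
  by rewrite big_map -mulr_sumr peval_word_deriv_nseq eqxx.
by rewrite big_map -mulr_sumr peval_word_deriv_nseq ji mulr0.
Qed.

Let in_segment (a r t : R) :
  `[a - r, a + r]%classic t <-> `|t - a| <= r.
Proof. by rewrite /= in_itv/= ler_distl. Qed.

Let cube x (r : R) : set {ptws I -> R} :=
  [set z | forall j, `[x j - r, x j + r]%classic (z j)].

Let cube_compact x r : compact (cube x r).
Proof.
apply: (@tychonoff I (fun=> R) (fun j => `[x j - r, x j + r]%classic)) => j.
exact: segment_compact.
Qed.

Let face x (r : R) (i : I) : set {ptws I -> R} :=
  [set z | forall j, (if j == i then [set x j - r] `|` [set x j + r]
                      else `[x j - r, x j + r]%classic) (z j)].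

Let face_compact x r i : compact (face x r i).
Proof.
apply: (@tychonoff I (fun=> R) (fun j => if j == i
  then [set x j - r] `|` [set x j + r] else `[x j - r, x j + r]%classic)) => j.
case: (j == i); last exact: segment_compact.
by apply: compactU; exact: compact_set1.
Qed.

(** The strict inequality on a face of the cube is uniform, by compactness. *)
Lemma strict_min_face s x (r : R) i : 0 < r ->
  (forall z, (forall j, `|z j - x j| <= r) -> z <> x ->
     peval id x s < peval id z s) ->
  exists2 eta, peval id x s < eta &
    forall z, (forall j, `|z j - x j| <= r) -> `|z i - x i| = r ->
      eta <= peval id z s.
Proof.
move=> r0 xmin.
have face0 : face x r i !=set0.
  exists (fun j => x j + r) => j; case: (j == i); first by right.
  by apply/in_segment; rewrite addrAC subrr add0r ger0_norm// ltW.
have fcont : {within face x r i, continuous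
    (fun z : {ptws I -> R} => peval id z s)}.
  by apply: continuous_subspaceT; exact: peval_continuous.
have [c /set_mem cF cmin] := compact_EVT_min face0 (@face_compact x r i) fcont.
have c_near j : `|c j - x j| <= r.
  have := cF j; case: (j == i) => [|/in_segment//].
  by case=> ->; rewrite addrAC subrr add0r ?normrN gtr0_norm.
exists (peval id c s) => [|z zr zi].
  apply: xmin => // cx; have := cF i; rewrite eqxx cx.
  case=> /eqP; rewrite -subr_eq0.
    by rewrite opprB addrC subrK gt_eqF.
  by rewrite opprD addrA subrr add0r oppr_eq0 gt_eqF.
apply: cmin; rewrite inE => j; have [->/=|ji] := eqVneq j i.
  have /eqP := zi; rewrite eqr_norml => /andP[/orP[]/eqP zE _].
    by right; rewrite -zE addrC subrK.
  by left; rewrite -zE addrC subrK.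
exact/in_segment.
Qed.

(** The polynomial [s] plus [e / d.+2 * \sum_j z j ^+ d.+2] attains its minimum
    over the cube of radius [r] around [x]. For small [e] the value at [x] stays
    below the values on the faces, where the added term only helps since its
    exponent is even; so the minimum is interior and its gradient vanishes. *)
Lemma perturbed_critical_point s x (r : R) (d : nat) : ~~ odd d -> 0 < r ->
  (forall z, (forall j, `|z j - x j| <= r) -> z <> x ->
     peval id x s < peval id z s) ->
  \forall e \near 0^'+, exists2 z : I -> R, forall i, `|z i - x i| < r &
    forall i, e * z i ^+ d.+1 = - peval id z (poly_deriv i s).
Proof.
move=> dE r0 xmin.
have /fin_all_exists2[eta eta_gt eta_le] i := strict_min_face i r0 xmin.
pose q z := (d.+2)%:R^-1 * \sum_j z j ^+ d.+2.
have q_ge0 z : 0 <= q z.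
  rewrite mulr_ge0// sumr_ge0// => j _.
  by apply: exprn_even_ge0; rewrite /= negbK.
have small_near : \forall e \near (0 : R)^'+,
    forall i, e * q x < eta i - peval id x s.
  apply: filter_forall => i.
  have : e * q x @[e --> 0^'+] --> 0 * q x.
    by apply: cvgM; [exact: cvg_at_right_filter cvg_id|exact: cvg_cst].
  by rewrite mul0r => /cvgr_lt; apply; rewrite subr_gt0.
near=> e.
have e0 : 0 < e by [].
have e_small i : e * q x < eta i - peval id x s.
  by move: i; near: e.
pose se := s ++ power_sum d.+2 (e / d.+2%:R).
have seE z : peval id z se = peval id z s + e * q z.
  by rewrite peval_cat peval_power_sum mulrA.
have cube0 : cube x r !=set0.
  by exists x => j; apply/in_segment; rewrite subrr normr0 ltW.
have fcont : {within cube x r, continuous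
    (fun z : {ptws I -> R} => peval id z se)}.
  by apply: continuous_subspaceT; exact: peval_continuous.
have [z /set_mem zQ zmin] := compact_EVT_min cube0 (@cube_compact x r) fcont.
have z_le j : `|z j - x j| <= r.
  by apply/in_segment; exact: zQ.
have z_in i : `|z i - x i| < r.
  rewrite lt_neqAle z_le andbT; apply/eqP => zi.
  have : peval id z se <= peval id x se.
    apply: zmin; rewrite inE => j.
    by apply/in_segment; rewrite subrr normr0 ltW.
  apply/negP; rewrite -ltNge !seE.
  apply: (lt_le_trans (y := eta i)).
    by rewrite -ltrBrDl.
  by rewrite (le_trans (eta_le i z z_le zi))// lerDl mulr_ge0// ltW.
exists z => // i; apply/eqP; rewrite -subr_eq0 opprK; apply/eqP.
rewrite addrC.
have -> : e * z i ^+ d.+1 =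
    peval id z (poly_deriv i (power_sum d.+2 (e / d.+2%:R))).
  by rewrite peval_deriv_power_sum mulrA divfK// pnatr_eq0.
rewrite -peval_cat -poly_deriv_cat -/se.
apply: (@peval_deriv_min _ _ (r - `|z i - x i|)); first by rewrite subr_gt0.
move=> t tr; apply: zmin; rewrite inE => j.
apply/in_segment; case: eqP => [->|_]; last by rewrite addr0 z_le.
by rewrite addrAC (le_trans (ler_normD _ _))// -lerBrDl ltW.
Unshelve. all: by end_near. Qed.

End PerturbedMinimum.

(** * Strict local minima depend algebraically on a parameter *)

Section AlgebraicBranch.
Variable R : realType.

Lemma cvg_horner2 (T : Type) (F : set_system T) (FF : Filter F)
    (p : {poly {poly R}}) (u v : T -> R) (a b : R) :
  u t @[t --> F] --> a -> v t @[t --> F] --> b ->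
  p.[u t, v t] @[t --> F] --> p.[a, b].
Proof.
move=> ua vb.
have hE (c e : R) : p.[c, e] = \sum_(i < size p) (p`_i).[e] * c ^+ i.
  rewrite (horner_coef p) horner_sum; apply: eq_bigr => i _.
  by rewrite hornerM -rmorphXn hornerC.
rewrite hE; under eq_cvg do rewrite hE.
have cadd : continuous (fun x : R * R => x.1 + x.2).
  by move=> x; apply: cvgD; [exact: cvg_fst|exact: cvg_snd].
apply: (@cvg_big R _ +%R 0 xpredT cadd T F _
  (fun (i : 'I_(size p)) t => (p`_i).[v t] * u t ^+ i)) => i _.
apply: (@cvgM R _ F _ (fun t => (p`_i).[v t]) (fun t => u t ^+ i)).
  exact: (cvg_comp v (horner p`_i) vb (@continuous_horner _ _ b)).
exact: (cvg_comp u (fun x => x ^+ i) ua (@exprn_continuous _ i a)).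
Qed.

(** Divided by [e^-1 ^+ n], the polynomial [p.[e^-1, _]] becomes [q.[e, _]] for
    the reversed polynomial [q], which extends continuously to [e = 0] with value
    [p`_n]. *)
Lemma lead_coef_root_at_infinity (p : {poly {poly R}}) n (t : R) :
  (size p <= n.+1)%N ->
  (forall delta : R, 0 < delta -> \forall e \near 0^'+,
    exists2 t', `|t' - t| < delta & p.[e^-1, t'] = 0) ->
  (p`_n).[t] = 0.
Proof.
move=> pn zeros; pose q := \poly_(i < n.+1) p`_(n - i).
have q0 : q.[0, t] = (p`_n).[t].
  by rewrite horner_coef0 coef_poly subn0.
have qE (e t' : R) : e != 0 -> q.[e, t'] = e ^+ n * p.[e^-1, t'].
  move=> e0; rewrite horner_poly (horner_coef_wide _ pn) !horner_sum mulr_sumr.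
  rewrite (reindex_inj rev_ord_inj)/=; apply: eq_bigr => i _.
  rewrite subSS subKn -1?ltnS// !hornerM -!rmorphXn !hornerC mulrCA.
  by rewrite exprVn exprB ?unitfE// -ltnS.
apply/eqP; rewrite -q0; apply: contraT => qt0.
have q_cvg : q.[w.1, w.2] @[w --> ((0 : R), t)] --> q.[0, t].
  by apply: cvg_horner2; [exact: cvg_fst|exact: cvg_snd].
have q_neq0 : \forall w \near ((0 : R), t), q.[w.1, w.2] != 0.
  by apply: (cvgr_neq0 _ q_cvg qt0).
have [eps /= eps0 ball_neq0] := (nbhs_ballP _ _).1 q_neq0.
have : \forall e \near (0 : R)^'+, False.
  near=> e.
  have e0 : 0 < e by [].
  have e_eps : e < eps by near: e; exact: nbhs_right_lt.
  have [t' t't pt'] : exists2 t', `|t' - t| < eps & p.[e^-1, t'] = 0.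
    by near: e; exact: zeros.
  have := ball_neq0 (e, t'); rewrite /= qE ?(lt0r_neq0 e0)// pt' mulr0 eqxx.
  move=> absurd; suff : ~~ true by []; apply: absurd.
  split => /=; last by rewrite /ball/= distrC.
  rewrite /ball/= sub0r normrN gtr0_norm//.
by move=> /filter_ex[].
Unshelve. all: by end_near. Qed.

Variables (I : finType) (d : nat) (s : seq ({poly R} * seq I)).

Definition specialize (mu : R) : seq (R * seq I) :=
  [seq (p.1.[mu], p.2) | p <- s].

Definition strict_local_min (mu : R) (x : I -> R) : Prop :=
  exists2 r : R, 0 < r & forall z : I -> R,
    (forall i, `|z i - x i| <= r) -> z <> x ->
    peval id x (specialize mu) < peval id z (specialize mu).

End AlgebraicBranch.

(** The eliminant of the perturbed critical equations is monic in [t], hence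
    nonzero; its leading coefficient in [e^-1] is therefore a nonzero polynomial
    in [mu] and [t], even if its value at the given [mu] may be the zero
    polynomial in [t]. The critical points converge to [x] as [e] tends to 0, so
    this coefficient vanishes at [x i0]. *)
Lemma algebraic_branch (R : realType) (I : finType) (d : nat)
    (s : seq ({poly R} * seq I)) (i0 : I) : ~~ odd d -> deg_le d.+1 s ->
  exists Q : {poly {poly R}},
    [/\ Q != 0, (size Q <= (d.+1 ^ #|I|).+1)%N &
        forall mu x, strict_local_min s mu x -> Q.[(x i0)%:P].[mu] = 0].
Proof.
move=> dE sd.
(* coefficient ring: the outer variable is [e^-1], the inner one is [mu] *)
pose g i : seq ({poly {poly R}} * seq I) :=
  [seq (- 'X * p.1%:P, p.2) | p <- poly_deriv i s].
have g_deg i : deg_le d (g i).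
  by rewrite /deg_le all_map; exact: poly_deriv_deg sd.
have [P [Pmonic Psize Proot]] := eliminant R g_deg i0.
pose W : {poly {poly {poly R}}} := swapXY P.
have W0 : W != 0 by rewrite swapXY_eq0 monic_neq0.
exists (lead_coef W); split; first by rewrite lead_coef_eq0.
  by rewrite (leq_trans (max_size_lead_coefXY W))// sizeYE swapXYK Psize.
move=> mu x [r r0 xmin].
pose ev := horner_eval mu : {rmorphism {poly R} -> R}.
pose Wmu := map_poly (map_poly ev) W.
have <- : (Wmu`_(size W).-1).[x i0] = (lead_coef W).[(x i0)%:P].[mu].
  rewrite coef_map -/(lead_coef W) -[RHS]/(ev _) -horner_map/=.
  by rewrite /ev /horner_eval hornerC.
apply: lead_coef_root_at_infinity => [|delta delta0].
  by rewrite (leq_trans (size_poly _ _))// leqSpred.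
pose rho := Num.min delta r.
have rho0 : 0 < rho by rewrite lt_min delta0.
have rmin z : (forall j, `|z j - x j| <= rho) -> z <> x ->
    peval id x (specialize s mu) < peval id z (specialize s mu).
  move=> zr; apply: xmin => j.
  by rewrite (le_trans (zr j))// ge_min lexx orbT.
near=> e.
have e0 : 0 < e by [].
have [z zx zcrit] : exists2 z : I -> R, forall i, `|z i - x i| < rho &
    forall i, e * z i ^+ d.+1 =
      - peval id z (poly_deriv i (specialize s mu)).
  by near: e; exact: (perturbed_critical_point dE rho0 rmin).
exists (z i0); first by rewrite (lt_le_trans (zx i0))// ge_min lexx.
pose phi := (ev \o horner_eval (e^-1)%:P) : {rmorphism {poly {poly R}} -> R}.
have zsol : solves d g phi z.
  move=> i; apply: (mulfI (lt0r_neq0 e0)); rewrite zcrit.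
  have -> : poly_deriv i (specialize s mu) = specialize (poly_deriv i s) mu.
    exact: (poly_deriv_map (horner_eval mu)).
  rewrite /peval !big_map mulr_sumr -sumrN.
  apply: eq_bigr => p _ /=; rewrite /ev /horner_eval !hornerE /=.
  by rewrite mulrN mulfV ?lt0r_neq0// mulN1r mulNr.
have := Proot phi z zsol; rewrite /root => /eqP <-.
rewrite map_poly_comp -(horner_swapXY P) -/W -[in RHS]horner_map/=.
by rewrite map_polyC/= horner_evalE hornerC.
Unshelve. all: by end_near. Qed.

(** * Convergence rate of algebraic functions *)

(** After division by the largest power of [mu], [Q] restricts at [mu = 0] to a
    nonzero polynomial [q0] of degree at most [D], and [q0.[x mu] = O (mu)]. Near
    [l] this polynomial is comparable to [(t - l) ^+ k] for some [k <= D]. *)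
Lemma algebraic_rate (R : realType) (Q : {poly {poly R}}) (D : nat)
    (x : R -> R) (l : R) :
  Q != 0 -> (size Q <= D.+1)%N ->
  (forall mu : R, 0 < mu -> Q.[x mu, mu] = 0) ->
  x mu @[mu --> 0^'+] --> l ->
  exists2 K : R, 0 < K &
    \forall mu \near 0^'+, `|x mu - l| ^+ D <= K * mu.
Proof.
move=> Q0 Qsize Qx xl; pose V := swapXY Q.
have V0 : V != 0 by rewrite swapXY_eq0.
have [j [V' /implyP/(_ V0) V'0 VE]] := multiplicity_XsubC V 0.
rewrite polyC0 subr0 in VE.
have V'x (mu : R) : 0 < mu -> V'.[mu, x mu] = 0.
  move=> mu0; have /eqP := Qx mu mu0.
  rewrite -horner2_swapXY -/V VE hornerM hornerXn hornerM -rmorphXn hornerC.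
  by rewrite mulf_eq0 expf_eq0 (gt_eqF mu0) andbF orbF => /eqP.
pose q0 := V'.[0]; have q00 : q0 != 0 by [].
have q0_size : (size q0 <= D.+1)%N.
  have -> : q0 = V`_j by rewrite VE coefMXn ltnn subnn /q0 horner_coef0.
  by rewrite (leq_trans (max_size_coefXY _ _))// sizeYE swapXYK.
have [W WE] : exists W, V' - q0%:P = W * ('X - 0%:P).
  by apply/factor_theorem; rewrite /root !hornerE subrr.
have [k [u /implyP/(_ q00) ul q0E]] := multiplicity_XsubC q0 l.
have u0 : u != 0 by apply: contraNneq ul => ->; exact: root0.
have kD : (k <= D)%N.
  rewrite -ltnS; apply: leq_trans q0_size.
  rewrite q0E size_Mmonic ?monic_exp ?monicXsubC// size_exp_XsubC addnS /=.
  by rewrite -add1n leq_add2r lt0n size_poly_eq0.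
have mu_to0 : mu @[mu --> (0 : R)^'+] --> (0 : R).
  by apply: cvg_at_right_filter; exact: cvg_id.
have W_cvg : W.[mu, x mu] @[mu --> 0^'+] --> W.[0, l] by exact: cvg_horner2.
have u_cvg : u.[x mu] @[mu --> 0^'+] --> u.[l].
  exact: (cvg_comp x (horner u) xl (@continuous_horner _ _ l)).
have c0 : 0 < `|u.[l]| / 2 by rewrite divr_gt0 ?normr_gt0.
pose M : R := `|W.[0, l]| + 1; have M0 : 0 < M by rewrite ltr_wpDl.
exists (M / (`|u.[l]| / 2)); first exact: divr_gt0.
near=> mu.
have mu0 : 0 < mu by [].
have W_le : `|W.[mu, x mu]| <= M.
  by near: mu; apply: (cvgr_norm_le _ W_cvg); rewrite ltrDl.
have u_ge : `|u.[l]| / 2 <= `|u.[x mu]|.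
  near: mu; apply: (cvgr_norm_ge _ u_cvg).
  by rewrite ltr_pdivrMr// ltr_pMr ?ltr1n// normr_gt0.
have x_le1 : `|x mu - l| <= 1.
  by near: mu; move/cvgrPdistC_le: xl => /(_ _ ltr01).
have key : `|x mu - l| ^+ k * `|u.[x mu]| = mu * `|W.[mu, x mu]|.
  have := V'x mu mu0; rewrite -[V'](subrK q0%:P) WE polyC0 subr0.
  rewrite hornerD hornerM hornerX hornerC hornerD hornerM hornerC.
  move=> /eqP; rewrite addr_eq0 => /eqP WqE.
  have q0x : q0.[x mu] = u.[x mu] * (x mu - l) ^+ k.
    by rewrite q0E hornerM horner_exp hornerXsubC.
  rewrite -normrX mulrC -normrM -q0x -normrN -WqE normrM.
  by rewrite (gtr0_norm mu0) mulrC.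
apply: (@le_trans _ _ (`|x mu - l| ^+ k)).
  by rewrite ler_wiXn2l.
rewrite mulrAC ler_pdivlMr// (le_trans (y := `|x mu - l| ^+ k * `|u.[x mu]|))//.
  by rewrite ler_wpM2l// exprn_ge0.
by rewrite key mulrC ler_wpM2r// ltW.
Unshelve. all: by end_near. Qed.

Lemma algebraic_holder (R : realType) (Q : {poly {poly R}}) (D : nat)
    (x : R -> R) (l : R) : (0 < D)%N ->
  Q != 0 -> (size Q <= D.+1)%N ->
  (forall mu : R, 0 < mu -> Q.[x mu, mu] = 0) ->
  x mu @[mu --> 0^'+] --> l ->
  exists2 K : R, 0 < K &
    \forall mu \near 0^'+, `|x mu - l| <= K * mu `^ D%:R^-1.
Proof.
move=> D0 Q0 Qs Qx xl; have [K K0 Kle] := algebraic_rate Q0 Qs Qx xl.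
exists (K `^ D%:R^-1); first exact: powR_gt0.
near=> mu; have mu0 : 0 < mu by [].
have D_neq0 : D%:R != 0 :> R by rewrite pnatr_eq0 -lt0n.
have -> : `|x mu - l| = (`|x mu - l| ^+ D) `^ D%:R^-1.
  by rewrite -powR_mulrn// -powRrM mulfV// powRr1.
rewrite -powRM ?(ltW K0) ?(ltW mu0)//.
apply: ge0_ler_powR; rewrite ?nnegrE ?invr_ge0 ?exprn_ge0//.
  by rewrite mulr_ge0 ?(ltW K0) ?(ltW mu0).
by near: mu.
Unshelve. all: by end_near. Qed.

(** * Positive definite matrices *)

Section PositiveDefinite.
Variable R : realType.

(** Induction on the size: the Schur complement of the top left entry is again
    positive definite. *)
Lemma pdmx_cholesky n (S : 'M[R]_n) : pdmx S ->
  exists2 L : 'M[R]_n, L \in unitmx & S = L *m L^T.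
Proof.
elim: n S => [|n IHn] S.
  by exists 1%:M; rewrite ?unitmx1// [S]flatmx0 [RHS]flatmx0.
rewrite -[n.+1]/(1 + n)%N in S * => -[Ssym Spos].
pose a := S 0 0; pose c : 'cV[R]_n := dlsubmx S; pose B : 'M[R]_n := drsubmx S.
have SE : S = block_mx a%:M c^T c B.
  rewrite -{1}[S]submxK; congr block_mx.
    apply/matrixP => i j; rewrite !ord1 !mxE eqxx mulr1n.
    by congr (S _ _); apply/val_inj.
  by rewrite /c trmx_dlsub Ssym.
have Bsym : B^T = B by rewrite /B trmx_drsub Ssym.
have a0 : 0 < a.
  have := Spos (delta_mx 0 0); rewrite trmx_delta -rowE -colE !mxE; apply.
  by apply/eqP => /matrixP/(_ 0 0)/eqP; rewrite !mxE !eqxx oner_eq0.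
have a_neq0 := lt0r_neq0 a0.
pose B' := B - a^-1 *: (c *m c^T).
have [|L' L'unit B'E] := IHn B'.
  split; first by rewrite /B' linearB linearZ/= trmx_mul trmxK Bsym.
  move=> v v0; pose z : 'cV[R]_(1 + n) := col_mx (- a^-1 *: (c^T *m v)) v.
  have Sz : S *m z = col_mx 0 (B' *m v).
    rewrite SE mul_block_col mul_scalar_mx scalerA mulrN mulfV// scaleN1r addNr.
    by rewrite -scalemxAr scaleNr mulmxA mulmxBl -scalemxAl addrC.
  have -> : v^T *m B' *m v = z^T *m S *m z.
    by rewrite -mulmxA -[RHS]mulmxA Sz tr_col_mx mul_row_col mulmx0 add0r.
  apply: Spos; apply: contra_neq v0 => z0.
  by rewrite -[v](col_mxKd (- a^-1 *: (c^T *m v))) -/z z0 linear0.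
pose q := Num.sqrt a; have q0 : q != 0 by rewrite sqrtr_eq0 -ltNge.
have qq : q * q = a by rewrite -expr2 sqr_sqrtr// ltW.
exists (block_mx q%:M 0 (q^-1 *: c) L').
  by rewrite unitmxE det_lblock det_scalar1 unitrM unitfE q0 -unitmxE.
rewrite tr_block_mx mulmx_block SE; congr block_mx.
- by rewrite tr_scalar_mx -scalar_mxM mul0mx addr0 qq.
- by rewrite linearZ/= mul0mx addr0 mul_scalar_mx scalerA mulfV// scale1r.
- rewrite trmx0 mulmx0 addr0 tr_scalar_mx mul_mx_scalar scalerA mulfV//.
  by rewrite scale1r.
- rewrite -B'E linearZ/= -scalemxAl -scalemxAr scalerA -invfM qq.
  by rewrite addrC subrK.
Qed.

Lemma sqr_sum_le n (u : 'I_n -> R) :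
  (\sum_i u i) ^+ 2 <= n%:R * \sum_i u i ^+ 2.
Proof.
rewrite -(ler_pM2l (ltr0n R 2)) expr2 mulr_suml.
under eq_bigr do rewrite mulr_sumr.
apply: (@le_trans _ _ (\sum_(i < n) \sum_(j < n) (u i ^+ 2 + u j ^+ 2))).
  rewrite mulr_sumr; apply: ler_sum => i _.
  rewrite mulr_sumr; apply: ler_sum => j _.
  by rewrite -subr_ge0 mulr_natl addrAC -sqrrB sqr_ge0.
under eq_bigr do rewrite big_split/= sumr_const card_ord.
by rewrite big_split/= sumr_const card_ord sumrMnl -mulr2n !mulr_natl.
Qed.

Lemma gram_diagE n (v : 'cV[R]_n) : (v^T *m v) 0 0 = \sum_i v i 0 ^+ 2.
Proof. by rewrite mxE; apply: eq_bigr => i _; rewrite mxE expr2. Qed.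

(** With [S = L *m L^T] the quadratic form is the squared norm of [L^T *m v],
    which controls that of [v] because [L] is invertible. *)
Lemma pdmx_coercive n (S : 'M[R]_n) : pdmx S ->
  exists2 c : R, 0 < c &
    forall v : 'cV[R]_n, c * \sum_i v i 0 ^+ 2 <= (v^T *m S *m v) 0 0.
Proof.
move=> /pdmx_cholesky[L Lunit ->]; pose B := invmx L^T.
pose M := \sum_i n%:R * \sum_j B i j ^+ 2.
have M0 : 0 <= M.
  apply: sumr_ge0 => i _; rewrite mulr_ge0// sumr_ge0// => j _.
  exact: sqr_ge0.
exists (M + 1)^-1 => [|v]; first by rewrite invr_gt0 ltr_wpDl.
pose w := L^T *m v; pose W := \sum_i w i 0 ^+ 2.
have -> : v^T *m (L *m L^T) *m v = w^T *m w.
  by rewrite /w trmx_mul trmxK !mulmxA.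
rewrite gram_diagE -/W mulrC ler_pdivrMr ?ltr_wpDl//.
have w_le j : w j 0 ^+ 2 <= W.
  by rewrite /W (bigD1 j)//= lerDl sumr_ge0// => i _; exact: sqr_ge0.
have vE : v = B *m w by rewrite /w mulKmx// unitmx_tr.
apply: (@le_trans _ _ (W * M)); last first.
  by rewrite mulrDr mulr1 lerDl sumr_ge0// => i _; exact: sqr_ge0.
rewrite /M mulr_sumr; apply: ler_sum => i _; rewrite {1}vE mxE.
rewrite (le_trans (sqr_sum_le _))// mulrCA ler_wpM2l// mulr_sumr.
apply: ler_sum => j _.
by rewrite exprMn mulrC ler_wpM2r// sqr_ge0.
Qed.

Lemma pdmx_open n (S : 'M[R]_n) : pdmx S ->
  exists2 r : R, 0 < r & forall S' : 'M[R]_n,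
    S'^T = S' -> (forall i j, `|S' i j - S i j| <= r) -> pdmx S'.
Proof.
move=> /pdmx_coercive[c c0 Sc]; exists (c / n.+1%:R); first by rewrite divr_gt0.
move=> S' S'sym S'r; split=> // v v0.
pose nv := \sum_i v i 0 ^+ 2.
have nv0 : 0 < nv.
  rewrite lt_neqAle sumr_ge0 ?andbT => [|i _]; last exact: sqr_ge0.
  apply: contra_neq v0 => /esym/eqP.
  rewrite psumr_eq0 => [|i _]; last exact: sqr_ge0.
  move=> /allP vi; apply/matrixP => i j; rewrite ord1 mxE; apply/eqP.
  by rewrite -sqrf_eq0; apply: vi; exact: mem_index_enum.
pose K := S' - S.
have -> : v^T *m S' *m v = v^T *m S *m v + v^T *m K *m v.
  by rewrite -mulmxDl -mulmxDr /K addrC subrK.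
rewrite mxE; apply: (@lt_le_trans _ _ (c * nv - c / n.+1%:R * (n%:R * nv))).
  rewrite subr_gt0 mulrA ltr_pM2r// -mulrA gtr_pMr//.
  by rewrite mulrC ltr_pdivrMr// mul1r ltr_nat.
apply: lerD; first exact: Sc.
rewrite lerNl (le_trans (ler_norm _))// normrN.
apply: (@le_trans _ _ (c / n.+1%:R * (\sum_i `|v i 0|) ^+ 2)).
  rewrite mxE (le_trans (ler_norm_sum _ _ _))// expr2 mulrA mulr_sumr.
  apply: ler_sum => j _; rewrite normrM ler_wpM2r//.
  rewrite mxE (le_trans (ler_norm_sum _ _ _))// mulr_sumr.
  apply: ler_sum => i _; rewrite normrM mulrC ler_pM//.
    by rewrite !mxE S'r.
  by rewrite mxE.
rewrite ler_wpM2l ?divr_ge0 ?(ltW c0)//.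
rewrite (le_trans (sqr_sum_le _))// ler_wpM2l//.
by apply: ler_sum => i _; rewrite real_normK ?num_real.
Qed.

End PositiveDefinite.

(** * Uniqueness of the central solution *)

Section Uniqueness.
Variables (R : realType) (m n : nat).
Variables (A : 'I_m -> 'M[int]_n) (b : 'cV[int]_m) (C : 'M[int]_n).

(** The trace is the sum of the values of the quadratic form of [S] at the
    columns of [L]. *)
Lemma trace_congr_eq0 (S L : 'M[R]_n) : pdmx S ->
  \tr (L^T *m S *m L) = 0 -> L = 0.
Proof.
move=> [_ Spos] trL; apply/matrixP => i j; rewrite [RHS]mxE.
have cE k : (L^T *m S *m L) k k = ((col k L)^T *m S *m col k L) 0 0.
  rewrite tr_col -row_mul mxE [RHS]mxE; apply: eq_bigr => l _.
  by rewrite [row _ _ _ _]mxE [col _ _ _ _]mxE.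
have ge0 k : 0 <= (L^T *m S *m L) k k.
  rewrite cE; have [->|/Spos/ltW//] := eqVneq (col k L) 0.
  by rewrite mulmx0 mxE.
move/eqP: trL; rewrite psumr_eq0// => /allP/(_ j (mem_index_enum _)) /=.
rewrite cE; have [c0 _|/Spos/gt_eqF->//] := eqVneq (col j L) 0.
by move/matrixP: c0 => /(_ i 0); rewrite !mxE.
Qed.

(** Put [H := X' - X] and [K := S' - S]. The linear constraints make [H] and [K]
    orthogonal, and the equations [X *m S = mu%:M = X' *m S'] give
    [S *m H *m S' = - mu *: K]; hence [\tr (H *m S *m H *m S') = 0]. Factoring
    [S = L *m L^T], this is the trace of the congruence of [S'] by [H *m L]. *)
Lemma central_solution_unique (mu : R) X y S X' y' S' :
  lin_indep_constraints R A -> mu != 0 ->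
  primal_eqs A b X -> primal_eqs A b X' ->
  dual_eqs A C y S -> dual_eqs A C y' S' ->
  X *m S = mu%:M -> X' *m S' = mu%:M ->
  X^T = X -> X'^T = X' -> pdmx S -> pdmx S' ->
  [/\ X' = X, y' = y & S' = S].
Proof.
move=> Afree mu0 pX pX' dS dS' XS XS' Xsym X'sym Spd S'pd.
pose H := X' - X.
have SX : S *m X = mu%:M.
  have : (mu^-1 *: X) *m S = 1%:M.
    by rewrite -scalemxAl XS scale_scalar_mx mulVf.
  move/mulmx1C; rewrite -scalemxAr => /(congr1 ( *:%R mu)).
  by rewrite scalerA mulfV// scale1r scale_scalar_mx mulr1.
have KE : S' - S = \sum_i (y i 0 - y' i 0) *: realmx_of R (A i).
  have -> : S' = realmx_of R C - \sum_i y' i 0 *: realmx_of R (A i).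
    by rewrite -dS' addrAC subrr add0r.
  have -> : S = realmx_of R C - \sum_i y i 0 *: realmx_of R (A i).
    by rewrite -dS addrAC subrr add0r.
  rewrite opprB addrC addrA subrK -sumrB; apply: eq_bigr => i _.
  by rewrite scalerBl.
have trHK : \tr (H *m (S' - S)) = 0.
  rewrite KE mulmx_sumr raddf_sum big1// => i _ /=.
  rewrite -scalemxAr mxtraceZ mxtrace_mulC mulmxBr raddfB /=.
  have := pX i; have := pX' i; rewrite /mxinner => -> ->.
  by rewrite subrr mulr0.
have SHS : S *m H *m S' = - mu *: (S' - S).
  rewrite mulmxBr mulmxBl -mulmxA XS' SX mul_mx_scalar mul_scalar_mx.
  by rewrite scaleNr scalerBr opprB.
have [L Lunit SE] := pdmx_cholesky Spd.
have HL : H *m L = 0.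
  apply: (trace_congr_eq0 S'pd).
  rewrite trmx_mul mxtrace_mulC !mulmxA mxtrace_mulC.
  have -> : H^T = H by rewrite /H linearB/= Xsym X'sym.
  have -> : S' *m (H *m L *m L^T *m H) = S' *m (H *m S *m H).
    by rewrite SE !mulmxA.
  rewrite mxtrace_mulC.
  have -> : H *m S *m H *m S' = H *m (S *m H *m S') by rewrite !mulmxA.
  by rewrite SHS -scalemxAr mxtraceZ trHK mulr0.
have XE : X' = X.
  apply/eqP; rewrite -subr_eq0 -/H; apply/eqP.
  by rewrite -[H](mulmxK Lunit) HL mul0mx.
have S'E : S' = S.
  apply: (scalerI mu0); rewrite -!mul_scalar_mx -SX -!mulmxA.
  by rewrite XS -XS' XE.
split=> //; apply/matrixP => i j; rewrite ord1; apply/eqP.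
rewrite eq_sym -subr_eq0; apply/eqP.
move/freeP: Afree => /(_ (fun k => y k 0 - y' k 0)) yE; apply: yE.
rewrite -[RHS](subrr S) -{1}S'E KE.
by apply: eq_bigr => k _; rewrite -tnth_nth tnth_mktuple.
Qed.

End Uniqueness.

(** * The central path as a family of strict local minima *)

Section PolynomialFunctions.
Variables (R : realType) (I : finType).

(** [f mu z] is a polynomial in [z] of degree at most [k] with coefficients
    polynomial in [mu]: [k] bounds the degree in [z] alone, the only one that
    enters the exponent. *)
Definition is_polyfun (k : nat) (f : R -> (I -> R) -> R) : Prop :=
  exists2 s : seq ({poly R} * seq I), deg_le k s &
    forall mu z, peval id z (specialize s mu) = f mu z.

Lemma is_polyfun_coef k (p : {poly R}) : is_polyfun k (fun mu _ => p.[mu]).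
Proof.
exists [:: (p, [::])] => // mu z.
by rewrite /peval big_seq1 big_nil mulr1.
Qed.

Lemma is_polyfun_const k (c : R) : is_polyfun k (fun _ _ => c).
Proof.
have [s sk sE] := is_polyfun_coef k c%:P.
by exists s => // mu z; rewrite sE hornerC.
Qed.

Lemma is_polyfun_var k i : is_polyfun k.+1 (fun _ z => z i).
Proof.
exists [:: (1, [:: i])] => // mu z.
by rewrite /peval big_seq1 big_seq1 hornerC mul1r.
Qed.

Lemma is_polyfun_leq k l f : (k <= l)%N -> is_polyfun k f -> is_polyfun l f.
Proof.
move=> kl [s sk sE]; exists s => //; apply: sub_all sk => p /= pk.
exact: leq_trans pk kl.
Qed.

Lemma is_polyfunD k f g : is_polyfun k f -> is_polyfun k g ->
  is_polyfun k (fun mu z => f mu z + g mu z).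
Proof.
move=> [s sk sE] [t tk tE]; exists (s ++ t).
  by rewrite /deg_le all_cat; apply/andP.
by move=> mu z; rewrite /specialize map_cat peval_cat sE tE.
Qed.

Lemma is_polyfunM k l f g : is_polyfun k f -> is_polyfun l g ->
  is_polyfun (k + l) (fun mu z => f mu z * g mu z).
Proof.
move=> [s /allP sk sE] [t /allP tl tE].
exists [seq (p.1 * q.1, p.2 ++ q.2) | p <- s, q <- t].
  apply/allP => _ /allpairsP[[p q] [/= ps qt ->]] /=.
  by rewrite size_cat leq_add// ?sk ?tl.
move=> mu z; rewrite -sE -tE /peval /specialize !big_map big_allpairs_dep/=.
rewrite mulr_suml; apply: eq_bigr => p _.
rewrite mulr_sumr; apply: eq_bigr => q _ /=.
by rewrite hornerM big_cat/= mulrACA.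
Qed.

Lemma is_polyfun_sum k (J : finType) (f : J -> R -> (I -> R) -> R) :
  (forall j, is_polyfun k (f j)) ->
  is_polyfun k (fun mu z => \sum_j f j mu z).
Proof.
move=> fk; elim: (index_enum J) => [|j r IHr].
  have [s sk sE] := is_polyfun_const k 0.
  by exists s => // mu z; rewrite sE big_nil.
have [s sk sE] := is_polyfunD (fk j) IHr.
by exists s => // mu z; rewrite sE big_cons.
Qed.

Lemma is_polyfunB k f g : is_polyfun k f -> is_polyfun k g ->
  is_polyfun k (fun mu z => f mu z - g mu z).
Proof.
move=> fk gk; have := is_polyfunM (is_polyfun_const 0 (-1)) gk.
move=> /(is_polyfunD fk)[s sk sE]; exists s => // mu z.
by rewrite sE mulN1r.
Qed.

Lemma is_polyfun_sqr k f : is_polyfun k f ->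
  is_polyfun (k + k) (fun mu z => f mu z ^+ 2).
Proof. by move=> fk; exact: is_polyfunM. Qed.

End PolynomialFunctions.

Section CentralPathPolynomial.
Variables (R : realType) (m n : nat).
Variables (A : 'I_m -> 'M[int]_n) (b : 'cV[int]_m) (C : 'M[int]_n).

Definition unknown : finType := ('I_n * 'I_n + 'I_n * 'I_n + 'I_m)%type.

Implicit Type z : unknown -> R.
Definition X_of z : 'M[R]_n := \matrix_(i, j) z (inl (inl (i, j))).
Definition S_of z : 'M[R]_n := \matrix_(i, j) z (inl (inr (i, j))).
Definition y_of z : 'cV[R]_m := \col_i z (inr i).
Definition coordinates (X : 'M[R]_n) (y : 'cV[R]_m) (S : 'M[R]_n) :
    unknown -> R :=
  fun u => match u with
  | inl (inl ij) => X ij.1 ij.2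
  | inl (inr ij) => S ij.1 ij.2
  | inr i => y i 0
  end.

Lemma coordinatesK z : coordinates (X_of z) (y_of z) (S_of z) = z.
Proof. by apply/funext => -[[[i j]|[i j]]|i]; rewrite /= mxE. Qed.

(** The last sum forces [X] to be symmetric, which the equation [X *m S = mu%:M]
    by itself does not; the dual equations take care of [S]. *)
Definition residual (mu : R) z : R :=
  \sum_i (mxinner (realmx_of R (A i)) (X_of z) - realmx_of R b i 0) ^+ 2 +
  \sum_i \sum_j ((\sum_k y_of z k 0 *: realmx_of R (A k) + S_of z) i j
                 - realmx_of R C i j) ^+ 2 +
  \sum_i \sum_j ((X_of z *m S_of z) i j - (mu%:M : 'M[R]_n) i j) ^+ 2 +
  \sum_i \sum_j (X_of z i j - X_of z j i) ^+ 2.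

Lemma residual_polyfun : is_polyfun 4 residual.
Proof.
have Xpoly i j : is_polyfun 1 (fun _ z => X_of z i j).
  have [s sk sE] := is_polyfun_var R 0 (inl (inl (i, j)) : unknown).
  by exists s => // mu z; rewrite sE mxE.
have Spoly i j : is_polyfun 1 (fun _ z => S_of z i j).
  have [s sk sE] := is_polyfun_var R 0 (inl (inr (i, j)) : unknown).
  by exists s => // mu z; rewrite sE mxE.
have ypoly i : is_polyfun 1 (fun _ z => y_of z i 0).
  have [s sk sE] := is_polyfun_var R 0 (inr i : unknown).
  by exists s => // mu z; rewrite sE mxE.
apply: is_polyfunD; last first.
  apply: is_polyfun_sum => i; apply: is_polyfun_sum => j.
  apply: (@is_polyfun_leq _ _ 2) => //; apply: (@is_polyfun_sqr _ _ 1).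
  exact: is_polyfunB.
apply: is_polyfunD; last first.
  apply: is_polyfun_sum => i; apply: is_polyfun_sum => j.
  apply: (@is_polyfun_sqr _ _ 2); apply: is_polyfunB.
    have [s sk sE] :=
      is_polyfun_sum (fun k => is_polyfunM (Xpoly i k) (Spoly k j)).
    by exists s => // mu z; rewrite sE mxE.
  have [s sk sE] := is_polyfun_coef unknown 2 ('X *+ (i == j) : {poly R}).
  by exists s => // mu z; rewrite sE hornerMn hornerX mxE.
apply: is_polyfunD; last first.
  apply: is_polyfun_sum => i; apply: is_polyfun_sum => j.
  apply: (@is_polyfun_leq _ _ 2) => //; apply: (@is_polyfun_sqr _ _ 1).
  apply: is_polyfunB; last exact: is_polyfun_const.
  have yA k : is_polyfun 1 (fun _ z => y_of z k 0 * realmx_of R (A k) i j).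
    exact: (is_polyfunM (ypoly k) (is_polyfun_const _ 0 _)).
  have [s sk sE] := is_polyfunD (is_polyfun_sum yA) (Spoly i j).
  exists s => // mu z; rewrite sE [RHS]mxE summxE; congr (_ + _).
  by apply: eq_bigr => k _; rewrite [RHS]mxE.
apply: is_polyfun_sum => i.
apply: (@is_polyfun_leq _ _ 2) => //; apply: (@is_polyfun_sqr _ _ 1).
apply: is_polyfunB; last exact: is_polyfun_const.
have AX k l : is_polyfun 1 (fun _ z => realmx_of R (A i) k l * X_of z l k).
  exact: (is_polyfunM (is_polyfun_const _ 0 _) (Xpoly l k)).
have [s sk sE] := is_polyfun_sum (fun k => is_polyfun_sum (AX k)).
exists s => // mu z; rewrite sE; apply: eq_bigr => k _.
by rewrite mxE.
Qed.

Lemma residual_ge0 mu z : 0 <= residual mu z.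
Proof.
rewrite /residual !addr_ge0// sumr_ge0// => i _; rewrite ?sqr_ge0//.
- by rewrite sumr_ge0// => j _; rewrite sqr_ge0.
- by rewrite sumr_ge0// => j _; rewrite sqr_ge0.
- by rewrite sumr_ge0// => j _; rewrite sqr_ge0.
Qed.

Lemma residual_eq0 mu z : residual mu z = 0 <->
  [/\ primal_eqs A b (X_of z), dual_eqs A C (y_of z) (S_of z),
      X_of z *m S_of z = mu%:M & (X_of z)^T = X_of z].
Proof.
have sum_sqr_eq0 (J : finType) (f : J -> R) :
    \sum_j f j ^+ 2 = 0 <-> forall j, f j = 0.
  split=> [/eqP|f0]; last by rewrite big1// => j _; rewrite f0 expr0n.
  rewrite psumr_eq0 => [/allP f0 j|j _]; last exact: sqr_ge0.
  by apply/eqP; rewrite -sqrf_eq0; apply: f0; exact: mem_index_enum.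
have mx_sqr_eq0 (f : 'I_n -> 'I_n -> R) :
    \sum_i \sum_j f i j ^+ 2 = 0 <-> forall i j, f i j = 0.
  split=> [/eqP|f0]; last by rewrite big1// => i _; rewrite sum_sqr_eq0.
  rewrite psumr_eq0 => [/allP f0 i|i _].
    by apply/sum_sqr_eq0/eqP/f0; exact: mem_index_enum.
  by apply: sumr_ge0 => j _; exact: sqr_ge0.
rewrite /residual.
have splitE (a c d e : R) : 0 <= a -> 0 <= c -> 0 <= d -> 0 <= e ->
    a + c + d + e = 0 <-> (a = 0 /\ c = 0) /\ d = 0 /\ e = 0.
  move=> a0 c0 d0 e0; split=> [/eqP|[[-> ->] [-> ->]]]; last by rewrite !addr0.
  rewrite !paddr_eq0 ?addr_ge0// -!andbA.
  by case/and4P => /eqP-> /eqP-> /eqP-> /eqP->.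
rewrite splitE; try by do ?[apply: sumr_ge0 => ? _]; exact: sqr_ge0.
rewrite sum_sqr_eq0 !mx_sqr_eq0.
split=> [[[h1 h2] [h3 h4]]|[h1 h2 h3 h4]]; [split | do 2?split].
- by move=> i; apply/eqP; rewrite -subr_eq0 h1.
- by apply/matrixP => i j; apply/eqP; rewrite -subr_eq0 h2.
- by apply/matrixP => i j; apply/eqP; rewrite -subr_eq0 h3.
- by apply/matrixP => i j; apply/eqP; rewrite mxE -subr_eq0 h4.
- by move=> i; rewrite h1 subrr.
- by move=> i j; rewrite h2 subrr.
- by move=> i j; rewrite h3 subrr.
- by move=> i j; rewrite -{1}h4 mxE subrr.
Qed.

(** A zero of [residual] close to the central solution has a positive definite
    slack matrix, since this condition is open, and hence is the central
    solution itself. *)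
Lemma central_strict_local_min (s : seq ({poly R} * seq unknown)) (mu : R)
    X y S :
  (forall mu z, peval id z (specialize s mu) = residual mu z) ->
  (forall i, (A i)^T = A i) -> C^T = C ->
  lin_indep_constraints R A -> 0 < mu ->
  central_solution A b C mu X y S ->
  strict_local_min s mu (coordinates X y S).
Proof.
move=> sE Asym Csym Afree mu0 [pX dS XS [Xsym Xpos] Spd].
have [r r0 Sopen] := pdmx_open Spd.
have XE : X_of (coordinates X y S) = X by apply/matrixP => i j; rewrite mxE.
have SE : S_of (coordinates X y S) = S by apply/matrixP => i j; rewrite mxE.
have yE : y_of (coordinates X y S) = y.
  by apply/matrixP => i j; rewrite mxE ord1.
exists r => // z zr z_neq; rewrite !sE.
have -> : residual mu (coordinates X y S) = 0.
  by apply/residual_eq0; rewrite XE SE yE.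
rewrite lt_neqAle residual_ge0 andbT eq_sym; apply/eqP.
move=> /residual_eq0[pX' dS' XS' X'sym]; apply: z_neq.
have S'pd : pdmx (S_of z).
  apply: Sopen => [|i j].
    have -> : S_of z = realmx_of R C - \sum_i y_of z i 0 *: realmx_of R (A i).
      by rewrite -dS' addrAC subrr add0r.
    rewrite linearB/= linear_sum/= map_trmx Csym; congr (_ - _).
    by apply: eq_bigr => i _; rewrite linearZ/= map_trmx Asym.
  by rewrite mxE; exact: (zr (inl (inr (i, j)))).
have [X'E y'E S'E] := central_solution_unique Afree (lt0r_neq0 mu0) pX pX'
  dS dS' XS XS' Xsym X'sym Spd S'pd.
by rewrite -[z]coordinatesK X'E y'E S'E.
Qed.

End CentralPathPolynomial.

(** * The convergence rate of the central path *)

Lemma frob_norm_le (R : realType) n (M : 'M[R]_n) (k : R) : 0 <= k ->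
  (forall i j, `|M i j| <= k) -> frob_norm M <= n%:R * k.
Proof.
move=> k0 Mk; rewrite -[leRHS]ger0_norm ?mulr_ge0// -sqrtr_sqr.
rewrite ler_sqrt ?sqr_ge0//.
apply: (@le_trans _ _ (\sum_(i < n) \sum_(j < n) k ^+ 2)).
  apply: ler_sum => i _; apply: ler_sum => j _.
  by rewrite -[leLHS]real_normK ?num_real// lerXn2r// nnegrE.
by rewrite !sumr_const !card_ord -mulrnA exprMn -natrX mulr_natl -mulnn.
Qed.

Lemma central_path_entry_rate (R : realType) (m n : nat)
    (A : 'I_m -> 'M[int]_n) (b : 'cV[int]_m) (C : 'M[int]_n) :
  (forall i, (A i)^T = A i) -> C^T = C -> lin_indep_constraints R A ->
  forall (X : R -> 'M[R]_n) (y : R -> 'cV[R]_m) (S : R -> 'M[R]_n),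
  central_path A b C X y S ->
  forall (u : unknown m n) (l : R),
  coordinates (X mu) (y mu) (S mu) u @[mu --> 0^'+] --> l ->
  exists2 K : R, 0 < K & \forall mu \near 0^'+,
    `|coordinates (X mu) (y mu) (S mu) u - l| <=
      K * mu `^ ((5 ^ (n ^ 2 + n ^ 2 + m))%N%:R)^-1.
Proof.
move=> Asym Csym Afree X y S cp u l ul.
have [s s4 sE] := residual_polyfun R A b C.
have [|Q [Q0 Qsize Qroot]] := @algebraic_branch R (unknown m n) 4 s u isT.
  by apply: sub_all s4 => p /= /leq_trans; apply.
have card_unknown : #|unknown m n| = (n ^ 2 + n ^ 2 + m)%N.
  by rewrite !card_sum !card_prod !card_ord !mulnn.
rewrite card_unknown in Qsize.
apply: algebraic_holder Q0 Qsize _ ul; first by rewrite expn_gt0.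
move=> mu mu0; apply: Qroot; exact: central_strict_local_min (cp mu mu0).
Qed.

Theorem theorem1p1 (R : realType) :
  exists2 c : R, 0 < c &
  forall (m n : nat)
    (A : 'I_m -> 'M[int]_n) (b : 'cV[int]_m) (C : 'M[int]_n),
    (forall i, (A i)^T = A i) -> C^T = C ->
    lin_indep_constraints R A ->
    interior_point_condition R A b C ->
  forall (X : R -> 'M[R]_n) (y : R -> 'cV[R]_m) (S : R -> 'M[R]_n)
    (Xlim : 'M[R]_n) (ylim : 'cV[R]_m) (Slim : 'M[R]_n),
    central_path A b C X y S ->
    (X mu, y mu, S mu) @[mu --> 0^'+] --> (Xlim, ylim, Slim) ->
  exists gamma K mu0 : R,
    [/\ 0 < gamma <= 2 `^ (c * (m + n ^ 2)%:R), 0 < K, 0 < mu0 &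
        forall mu : R, 0 < mu <= mu0 ->
          frob_norm (X mu - Xlim) <= K * mu `^ gamma^-1 /\
          frob_norm (S mu - Slim) <= K * mu `^ gamma^-1].
Proof.
exists 6 => // m n A b C Asym Csym Afree _ X y S Xlim ylim Slim cp lim.
pose D := (5 ^ (n ^ 2 + n ^ 2 + m))%N.
have entry (u : unknown m n) : exists2 K : R, 0 < K & \forall mu \near 0^'+,
    `|coordinates (X mu) (y mu) (S mu) u - coordinates Xlim ylim Slim u| <=
      K * mu `^ D%:R^-1.
  apply: (central_path_entry_rate Asym Csym Afree cp).
  have Xl : X mu @[mu --> 0^'+] --> Xlim.
    exact: (cvg_comp _ _ (cvg_comp _ _ lim cvg_fst) cvg_fst).
  have yl : y mu @[mu --> 0^'+] --> ylim.
    exact: (cvg_comp _ _ (cvg_comp _ _ lim cvg_fst) cvg_snd).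
  have Sl : S mu @[mu --> 0^'+] --> Slim by exact: (cvg_comp _ _ lim cvg_snd).
  case: u => [[[i j]|[i j]]|i] /=.
  - exact: (cvg_comp _ _ Xl (@coord_continuous _ _ _ i j Xlim)).
  - exact: (cvg_comp _ _ Sl (@coord_continuous _ _ _ i j Slim)).
  - exact: (cvg_comp _ _ yl (@coord_continuous _ _ _ i 0 ylim)).
have /fin_all_exists2[K K0 rate] := entry.
(* one constant for all entries *)
pose k := 1 + \sum_u K u.
have k0 : 0 < k by rewrite ltr_wpDr// sumr_ge0// => u _; rewrite ltW.
have : \forall mu \near (0 : R)^'+, forall u,
    `|coordinates (X mu) (y mu) (S mu) u - coordinates Xlim ylim Slim u| <=
      K u * mu `^ D%:R^-1.
  exact: filter_forall.
move=> [e /= e0 near_rate].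
(* [n.+1] instead of [n] keeps the constant positive when [n = 0] *)
exists D%:R, (n.+1%:R * k), (e / 2); split.
- rewrite ltr0n expn_gt0/= -natrM powR_mulrn// -natrX ler_nat.
  apply: (@leq_trans (8 ^ (n ^ 2 + n ^ 2 + m))).
    by rewrite /D; elim: (_ + m)%N => // q IHq; rewrite !expnS leq_mul.
  rewrite -[8%N]/(2 ^ 3)%N -expnM leq_exp2l//.
  rewrite -[6%N]/(3 * 2)%N -mulnA leq_mul2l/= mul2n -addnn.
  by rewrite addnACA [leqRHS]addnC leq_add2l leq_addl.
- by rewrite mulr_gt0.
- by rewrite divr_gt0.
move=> mu /andP[mu0 mu_le].
have bound u : `|coordinates (X mu) (y mu) (S mu) u
    - coordinates Xlim ylim Slim u| <= k * mu `^ D%:R^-1.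
  have mu_e : ball 0 e mu.
    rewrite /ball/= sub0r normrN gtr0_norm// (le_lt_trans mu_le)//.
    by rewrite ltr_pdivrMr// ltr_pMr ?ltr1n.
  rewrite (le_trans (near_rate mu mu_e mu0 u))// ler_wpM2r ?powR_ge0//.
  rewrite /k (bigD1 u)//= addrCA lerDl addr_ge0// sumr_ge0// => v _.
  exact/ltW.
have frob_bound (M : 'M[R]_n) : (forall i j, `|M i j| <= k * mu `^ D%:R^-1) ->
    frob_norm M <= n.+1%:R * k * mu `^ D%:R^-1.
  have kmu0 : 0 <= k * mu `^ D%:R^-1 by rewrite mulr_ge0 ?powR_ge0// ltW.
  move=> /(frob_norm_le kmu0)/le_trans; apply.
  by rewrite -mulrA ler_wpM2r// ler_nat.
split; apply: frob_bound => i j; rewrite !mxE.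
  exact: (bound (inl (inl (i, j)))).
exact: (bound (inl (inr (i, j)))).
Qed.
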